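(* Let $n \in \mathbb{N}$ and $t \in \mathbb{N}_0$. Then there exists a finite set $X \subseteq M_n(\mathbb{R}_{\max})$ such that $t$ is the rank of the free abelian subgroup of $(\mathbb{R},+)$ generated as a group by the finite entries of the matrices in $\langle X\rangle$, and the growth function of $\langle X \rangle$ is bounded below by $ck^{tn^2}$ for some $c > 0$.
   Context: $\mathbb{N}$ is the set of positive integers and $\mathbb{N}_0$ the set of non-negative integers. $\mathbb{R}_{\max}=\mathbb{R}\cup\{-\infty\}$ is the tropical semiring, with semiring addition $\max$ and semiring multiplication the usual addition (zero $-\infty$, one $0$). $M_n(\mathbb{R}_{\max})$ is the monoid of all $n\times n$ matrices over $\mathbb{R}_{\max}$ under (tropical) matrix multiplication. A finite entry is an entry different from $-\infty$. $\langle X\rangle$ is the subsemigroup generated by $X$. For a semigroup generated by a finite set $X$, its growth function (with respect to $X$) is $f_X(k) = |\bigcup_{i=1}^k X^i|$ for $k\in\mathbb{N}$, where $X^i$ is the set of products of $i$ elements of $X$. It is bounded below by $ck^m$ if $f_X(k)\ge ck^m$ for all $k\in\mathbb{N}$. *)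

(* Defs.v *)
From HB Require Import structures.
From mathcomp Require Import all_boot all_order all_algebra.
From mathcomp Require Import finmap.
From mathcomp Require Import boolp classical_sets reals.

Set Implicit Arguments.
Unset Strict Implicit.
Unset Printing Implicit Defensive.

Import Order.TTheory GRing.Theory Num.Theory.

Local Open Scope fset_scope.
Local Open Scope classical_set_scope.
Local Open Scope ring_scope.

(* The max-plus semiring R \cup {-oo}: [None] is -oo, [Some x] is the finite
   element x. The semiring 0 is [None] and the semiring 1 is [Some 0]. *)
Definition tropical (R : realType) : Type := option R.

Section TropicalSemiring.
Variable R : realType.
Implicit Types a b : tropical R.

Definition trop_add a b : tropical R :=
  match a, b with
  | None, _ => b
  | _, None => a
  | Some x, Some y => Some (Num.max x y)
  end.

Definition trop_mul a b : tropical R :=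
  match a, b with
  | Some x, Some y => Some (x + y)
  | _, _ => None
  end.

Definition trop_zero : tropical R := None.
Definition trop_one : tropical R := Some 0.

HB.instance Definition _ := Choice.copy (tropical R) (option R).

Fact trop_addA : associative trop_add.
Proof. by move=> [x|] [y|] [z|] //=; rewrite maxA. Qed.

Fact trop_addC : commutative trop_add.
Proof. by move=> [x|] [y|] //=; rewrite maxC. Qed.

Fact trop_add0 : left_id trop_zero trop_add.
Proof. by case. Qed.

HB.instance Definition _ :=
  GRing.isNmodule.Build (tropical R) trop_addA trop_addC trop_add0.

Fact trop_mulA : associative trop_mul.
Proof. by move=> [x|] [y|] [z|] //=; rewrite addrA. Qed.

Fact trop_mulC : commutative trop_mul.
Proof. by move=> [x|] [y|] //=; rewrite addrC. Qed.

Fact trop_mul1 : left_id trop_one trop_mul.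
Proof. by case=> [x|] //=; rewrite add0r. Qed.

Fact trop_mulDl : left_distributive trop_mul trop_add.
Proof. by move=> [x|] [y|] [z|] //=; rewrite addr_maxl. Qed.

Fact trop_mul0 : left_zero trop_zero trop_mul.
Proof. by []. Qed.

Fact trop_one_neq0 : trop_one != trop_zero.
Proof. by []. Qed.

HB.instance Definition _ :=
  GRing.Nmodule_isComNzSemiRing.Build (tropical R)
    trop_mulA trop_mulC trop_mul1 trop_mulDl trop_mul0 trop_one_neq0.

End TropicalSemiring.

(* Only the multiplicative structure of [M] is used below; it is instantiated
   with the matrix semiring ['M[tropical R]_n]. *)
Section MultiplicativeSemigroup.
Variable M : pzSemiRingType.
Implicit Types X : {fset M}.

Definition mul_closed (S : set M) : Prop :=
  forall a b, S a -> S b -> S (a * b).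

Definition subsemigroup_gen (A : set M) : set M := smallest mul_closed A.

Fixpoint fset_pow X (i : nat) : {fset M} :=
  if i is j.+1 then [fset a * b | a in X, b in fset_pow X j]%fset
  else [fset 1]%fset.

Definition growth X (k : nat) : nat :=
  #|` (\bigcup_(i <- iota 1 k) fset_pow X i)%fset|.

End MultiplicativeSemigroup.

Definition subgroup_gen (V : zmodType) (A : set V) : set V :=
  smallest (fun G : set V => zmod_closed (mem G)) A.

Definition free_abelian_of_rank (V : zmodType) (G : set V) (t : nat) : Prop :=
  exists b : 'I_t -> V,
    (forall z : 'I_t -> int,
       \sum_(i < t) b i *~ z i = 0 -> forall i, z i = 0) /\
    G = range (fun z : 'I_t -> int => \sum_(i < t) b i *~ z i).

Definition finite_entries (R : realType) (n : nat)
    (S : set 'M[tropical R]_n) : set R :=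
  [set x | exists A i j, S A /\ A i j = Some x].

(* Main.v *)
Require Import Defs.
From mathcomp Require Import all_boot all_order all_algebra.
From mathcomp Require Import finmap.
From mathcomp Require Import boolp classical_sets reals.
From mathcomp Require Import exp.
From mathcomp Require Import zify.

(** Let [b_1, ..., b_t] be positive reals that are linearly independent over
the integers; the logarithms of [t] distinct primes are such, by unique
factorization ([exists_int_free]). The generating set ([small_mx]) consists of
all the matrices whose entries are -oo or combinations of the [b_l] with
coefficients -1, 0 and 1.

All finite entries of products stay in the lattice spanned by the [b_l], and
each [b_l] is itself an entry, so the group generated by the finite entries is
that lattice, free of rank [t] ([subgroup_gen_entries]).

For the growth, the point is that a matrix of finite reals [T] with zero
diagonal and [T i j + T j k <= T i k] can be assembled column by column: [T] is
the product, over [j], of the identity matrices whose column [j] has been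
replaced by that of [T] ([prod_replace_col]). Each factor is the conjugate, by a
diagonal matrix, of a fixed matrix with entries 0 and -oo
([replace_col_conj]), and a diagonal matrix with coefficients at most [K] is a
product of [K] generators ([fin_diag_pow]). So if the coefficients of [T] are
O(K), then [T] is a product of O(K) generators.

The triangle inequality is automatic when all off-diagonal coefficients lie in
[[-2K, -K]], because a sum of two of them is at most [-2K] and the [b_l] are
positive. This leaves about [K] free choices for each of the [t] coefficients of each of the [n^2 - n]
off-diagonal entries. Multiplying on the left by an arbitrary diagonal matrix
frees the [n] diagonal entries as well. The resulting [(K+1)^(t n^2)] matrices
are pairwise distinct by independence of the [b_l] ([family_mx_inj]), and they
all have word length O(K) ([family_mx_pow]). *)

Set Implicit Arguments.
Unset Strict Implicit.
Unset Printing Implicit Defensive.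

Import Order.TTheory GRing.Theory Num.Theory.

Local Open Scope classical_set_scope.
Local Open Scope ring_scope.

(** * Integer combinations of independent reals *)

Definition int_comb (R : realType) (t : nat) (b : 'I_t -> R)
  (z : 'I_t -> int) : R := \sum_(l < t) b l *~ z l.

Definition int_free (R : realType) (t : nat) (b : 'I_t -> R) : Prop :=
  forall z, int_comb b z = 0 -> forall l, z l = 0.

Section IntComb.
Variables (R : realType) (t : nat) (b : 'I_t -> R).
Implicit Types z w : 'I_t -> int.

Lemma eq_int_comb z w : z =1 w -> int_comb b z = int_comb b w.
Proof. by move=> e; apply: eq_bigr => l _; rewrite e. Qed.

Lemma int_combD z w :
  int_comb b (fun l => z l + w l) = int_comb b z + int_comb b w.
Proof. by rewrite -big_split; apply: eq_bigr => l _; rewrite mulrzDr. Qed.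

Lemma int_combN z : int_comb b (fun l => - z l) = - int_comb b z.
Proof. by rewrite -sumrN; apply: eq_bigr => l _; rewrite mulrNz. Qed.

Lemma int_comb0 : int_comb b (fun=> 0) = 0.
Proof. by apply: big1 => l _; rewrite mulr0z. Qed.

Lemma int_comb_delta l : int_comb b (fun k => (k == l)%:Z) = b l.
Proof.
rewrite /int_comb (bigD1 l) //= eqxx mulr1z big1 ?addr0 // => k.
by move=> /negbTE ->; rewrite mulr0z.
Qed.

Lemma int_comb_inj : int_free b ->
  forall z w, int_comb b z = int_comb b w -> z =1 w.
Proof.
move=> bfree z w e l; apply/eqP; rewrite -subr_eq0; apply/eqP.
apply: (bfree (fun l => z l - w l)).
by rewrite (int_combD z (fun l => - w l)) int_combN e subrr.
Qed.

Lemma int_comb_le z w : (forall l, 0 < b l) -> (forall l, z l <= w l) ->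
  int_comb b z <= int_comb b w.
Proof.
move=> b_gt0 le_zw; apply: ler_sum => l _.
by apply: ler_wpMz2l => //; apply: ltW.
Qed.

End IntComb.

Lemma exists_distinct_primes t :
  exists2 p : 'I_t -> nat, injective p & forall l, prime (p l).
Proof.
elim: t => [|t [p p_inj p_prime]]; first by exists (fun=> 2%N) => [[]|[]].
have [q p_lt_q q_prime] := prime_above (\max_(l < t) p l).
exists (fun l => if unlift ord_max l is Some k then p k else q); last first.
  by move=> l; case: unlift.
have neq_q k : p k <> q.
  by move=> e; move: p_lt_q; rewrite -e ltnNge leq_bigmax.
move=> k l; case: unliftP => [k'|] ->; case: unliftP => [l'|] -> //.
- by move=> /p_inj ->.
- by move=> /neq_q.
- by move=> /esym /neq_q.
Qed.

(** This is uniqueness of factorization: the exponents can be read off the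
product. *)
Lemma logn_prod_prime (t : nat) (p m : 'I_t -> nat) k :
  injective p -> (forall l, prime (p l)) ->
  logn (p k) (\prod_(l < t) p l ^ m l) = m k.
Proof.
move=> p_inj p_prime.
have pow_gt0 l : (0 < p l ^ m l)%N by rewrite expn_gt0 prime_gt0.
rewrite (bigD1 k) //= lognM // ?prodn_gt0 // pfactorK //.
rewrite -[RHS]addn0; congr addn.
elim/big_ind: _ => [|x y x0 y0|l neq_lk]; first by rewrite logn1.
- case: (posnP x) => [->|x_gt0]; first by rewrite mul0n logn0.
  case: (posnP y) => [->|y_gt0]; first by rewrite muln0 logn0.
  by rewrite lognM // x0 y0.
- by rewrite lognX logn_prime // (inj_eq p_inj) eq_sym (negbTE neq_lk) muln0.
Qed.

(** A vanishing integer combination of logarithms of primes, after its negative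
terms are moved to the other side, is an equality between two products of prime
powers, whose exponents must then agree. *)
Lemma exists_int_free (R : realType) t :
  exists b : 'I_t -> R, (forall l, 0 < b l) /\ int_free b.
Proof.
have [p p_inj p_prime] := exists_distinct_primes t.
have p_gt0 l : 0 < (p l)%:R :> R by rewrite ltr0n prime_gt0.
exists (fun l => ln (p l)%:R); split=> [l|z z0 k].
  by rewrite ln_gt0 // ltr1n prime_gt1.
pose m l := if z l is Posz i then i else 0%N.
pose n l := if z l is Negz i then i.+1 else 0%N.
have zE l : z l = (m l)%:Z - (n l)%:Z.
  by rewrite /m /n; case: (z l) => i; rewrite ?subr0 // NegzE sub0r.
have lnE (s : 'I_t -> nat) :
    int_comb (fun l => ln (p l)%:R) (fun l => (s l)%:Z) =
    ln (\prod_(l < t) p l ^ s l)%:R :> R.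
  rewrite natr_prod.
  suff [_ ->] : 0 < \prod_(l < t) (p l ^ s l)%:R :> R /\
      ln (\prod_(l < t) (p l ^ s l)%:R) =
      \sum_(l < t) ln ((p l)%:R : R) *~ (s l)%:Z by [].
  elim/big_rec2: _ => [|l y1 y2 _ [y2_gt0 <-]]; first by rewrite ltr01 ln1.
  have q_gt0 : 0 < (p l ^ s l)%:R :> R by rewrite natrX exprn_gt0.
  by rewrite mulr_gt0 // lnM // natrX lnXn // pmulrn.
have /ln_inj : ln (\prod_(l < t) p l ^ m l)%:R =
               ln (\prod_(l < t) p l ^ n l)%:R :> R.
  apply/eqP; rewrite -!lnE -subr_eq0 -int_combN -int_combD -[X in _ == X]z0.
  by apply/eqP/eq_int_comb => l; rewrite zE.
have prod_gt0 s : (\prod_(l < t) p l ^ s l)%:R \is @Num.pos R.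
  by rewrite posrE ltr0n prodn_gt0 // => l; rewrite expn_gt0 prime_gt0.
move=> /(_ (prod_gt0 _) (prod_gt0 _)) /eqP; rewrite eqr_nat => /eqP.
move=> /(congr1 (logn (p k))); rewrite !logn_prod_prime // => mn.
by rewrite zE mn subrr.
Qed.

(** * Powers of a finite set containing the identity *)

Section Powers.
Variables (M : pzSemiRingType) (X : {fset M}).

Lemma fset_powD i j a c : a \in fset_pow X i -> c \in fset_pow X j ->
  a * c \in fset_pow X (i + j).
Proof.
elim: i a => [|i IH] a /=; first by rewrite inE => /eqP ->; rewrite mul1r.
move=> /imfset2P[x xX [y yX ->]] cX; rewrite -mulrA.
by apply: in_imfset2 => //; apply: IH.
Qed.

Lemma fset_pow1 a : a \in X -> a \in fset_pow X 1.
Proof. by move=> aX; rewrite -[a]mulr1; apply: in_imfset2; rewrite ?inE. Qed.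

(** Words can be padded with the identity, so an upper bound on the length of a
word is as good as its exact length. *)
Lemma fset_pow_leq i j a : 1 \in X -> (i <= j)%N ->
  a \in fset_pow X i -> a \in fset_pow X j.
Proof.
move=> X1 /subnKC <- aX; rewrite -[a]mulr1; apply: fset_powD => //.
elim: (j - i)%N => [|k IH]; first by rewrite /= inE.
by rewrite -[1]mulr1; apply: in_imfset2.
Qed.

Lemma fset_pow_prod (I : Type) (r : seq I) (F : I -> M) k :
  (forall i, F i \in fset_pow X k) ->
  \prod_(i <- r) F i \in fset_pow X (size r * k).
Proof.
move=> FX; elim: r => [|i r IH]; first by rewrite big_nil inE.
by rewrite big_cons mulSn; apply: fset_powD.
Qed.

Lemma fset_pow_growth k (I : finType) (F : I -> M) :
  (0 < k)%N -> injective F -> (forall i, F i \in fset_pow X k) ->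
  (#|I| <= growth X k)%N.
Proof.
move=> k_gt0 F_inj FX.
have <- : #|` [fset F i | i in I]%fset| = #|I|.
  by rewrite card_imfset //= -cardE.
apply: fsubset_leq_card; apply: (@fsubset_trans _ (fset_pow X k)).
  by apply/fsubsetP => _ /imfsetP[i _ ->].
by apply: (bigfcup_sup (P := xpredT)) => //; rewrite mem_iota k_gt0 add1n ltnSn.
Qed.

End Powers.

(** * Tropical matrix factorization *)

Section TropicalMatrix.
Variables (R : realType) (n : nat).

Definition fin_mx (T : 'I_n -> 'I_n -> R) : 'M[tropical R]_n :=
  \matrix_(i, j) (Some (T i j) : tropical R).

Definition fin_diag (d : 'I_n -> R) : 'M[tropical R]_n :=
  diag_mx (\row_i (Some (d i) : tropical R)).

Definition replace_col (T : 'I_n -> 'I_n -> R) (j : 'I_n) : 'M[tropical R]_n :=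
  \matrix_(i, k)
    if k == j then Some (T i j) : tropical R else (1%:M : 'M[tropical R]_n) i k.

(** In the max-plus semiring [a + x = a] means [x <= a]: a sum is attained at a
term that dominates the others. *)
Lemma trop_sum_absorb (I : eqType) (r : seq I) (P : pred I)
    (F : I -> tropical R) a :
  (forall i, P i -> a + F i = a) -> a + \sum_(i <- r | P i) F i = a.
Proof.
move=> aF; elim/big_rec: _ => [|i x Pi IH]; first by rewrite addr0.
by rewrite addrA aF.
Qed.

Lemma mul_replace_col (A : 'M[tropical R]_n) T j i k :
  (A * replace_col T j) i k =
  if k == j then \sum_m A i m * (Some (T m j) : tropical R) else A i k.
Proof.
rewrite !mxE; have [->|neq_kj] := eqVneq k j.
  by apply: eq_bigr => m _; rewrite mxE eqxx.
rewrite (bigD1 k) //= !mxE eqxx (negbTE neq_kj) mulr1 big1 ?addr0 // => m neq_mk.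
by rewrite !mxE (negbTE neq_kj) (negbTE neq_mk) mulr0.
Qed.

(** Right multiplication by the [j]-th factor changes column [j] only. The new
entry [(i, j)] is the maximum of [T i j], which comes from the unit in position
[(i, i)], and of some [T i m + T m j], which the triangle inequality bounds by
[T i j]. Hence every partial product agrees with [T] on the columns treated so
far and with the identity on the others. *)
Lemma prod_replace_col (T : 'I_n -> 'I_n -> R) :
  (forall i, T i i = 0) -> (forall i j k, T i j + T j k <= T i k) ->
  \prod_(j < n) replace_col T j = fin_mx T.
Proof.
move=> T0 T_tri.
suff prefix (s : seq 'I_n) i k : (\prod_(j <- s) replace_col T j) i k =
    if k \in s then Some (T i k) else (1%:M : 'M[tropical R]_n) i k.
  by apply/matrixP=> i k; rewrite prefix mem_index_enum mxE.
elim/last_ind: s i k => [|s j IH] i k; first by rewrite big_nil.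
rewrite -cats1 big_cat big_seq1 /= mul_replace_col cats1 mem_rcons inE.
have [->|_] /= := eqVneq k j; last exact: IH.
rewrite (bigD1 i) //= IH.
have -> : (if i \in s then Some (T i i) else (1%:M : 'M[tropical R]_n) i i)
          = (1 : tropical R).
  by rewrite mxE eqxx T0; case: ifP.
rewrite mul1r; apply: trop_sum_absorb => m neq_mi; rewrite IH.
case: ifP => _; first by congr Some; rewrite max_l.
by rewrite mxE eq_sym (negbTE neq_mi).
Qed.

(** The instance of [replace_col] whose [j]-th column consists of tropical
ones, that is, of the real number 0. *)
Definition zero_col (j : 'I_n) : 'M[tropical R]_n :=
  \matrix_(i, k) if (k == j) || (i == k) then 1 else 0.

(** Conjugation by [diag(T i j)] adds [T i j - T k j] to entry [(i, k)]. On the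
diagonal this is 0, and in column [j] it is [T i j] because [T j j = 0]. *)
Lemma replace_col_conj (T : 'I_n -> 'I_n -> R) j : T j j = 0 ->
  replace_col T j =
  fin_diag (fun i => T i j) * zero_col j * fin_diag (fun i => - T i j).
Proof.
move=> T0; rewrite -mulmxE mul_diag_mx mul_mx_diag.
apply/matrixP=> i k; rewrite !mxE.
have [->|_] /= := eqVneq k j.
  by rewrite T0 oppr0 mulr1; congr Some; rewrite addr0.
have [->|_] /= := eqVneq i k; last by rewrite mulr0 mul0r.
by congr Some; rewrite addr0 subrr.
Qed.

Lemma fin_diagD d e : fin_diag (fun i => d i + e i) = fin_diag d * fin_diag e.
Proof.
by rewrite -mulmxE mulmx_diag; congr diag_mx; apply/rowP=> i; rewrite !mxE.
Qed.

Lemma eq_fin_diag d e : d =1 e -> fin_diag d = fin_diag e.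
Proof. by move=> de; congr diag_mx; apply/rowP=> i; rewrite !mxE de. Qed.

End TropicalMatrix.

(** * The generating set *)

Section Generators.
Variables (R : realType) (n t : nat) (b : 'I_t -> R).

(** [None] codes -oo, and a value [v] in ['I_3] codes the coefficient [v - 1].
Coding the entries by a finite type makes the matrices of codes a finite type,
which gives the generating set as an image. *)
Definition code := option {ffun 'I_t -> 'I_3}.

Definition code_val (c : code) : tropical R :=
  if c is Some f then Some (int_comb b (fun l => (f l)%:Z - 1)) else None.

Definition small_mx : {fset 'M[tropical R]_n} :=
  [fset (map_mx code_val A : 'M[tropical R]_n) | A in 'M[code]_n]%fset.

Definition small_entry (a : tropical R) : Prop :=
  a = 0 \/ exists2 z, (forall l, -1 <= z l <= 1) & a = Some (int_comb b z).

Lemma small_mxP (A : 'M[tropical R]_n) :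
  (forall i j, small_entry (A i j)) -> A \in small_mx.
Proof.
move=> Asmall.
have codeA i j : exists c, code_val c = A i j.
  have [->|[z z_small ->]] := Asmall i j; first by exists None.
  exists (Some [ffun l => inord `|z l + 1|]); congr Some.
  apply: eq_int_comb => l; rewrite ffunE; have := z_small l => zl.
  by rewrite inordK; lia.
have [c cE] := choice (fun ij : 'I_n * 'I_n => codeA ij.1 ij.2).
apply/imfsetP; exists (\matrix_(i, j) c (i, j)) => //.
by apply/matrixP=> i j; rewrite !mxE cE.
Qed.

Lemma small_entry1 : small_entry 1.
Proof. by right; exists (fun=> 0) => //; rewrite int_comb0. Qed.

Lemma small_mx1 : 1 \in small_mx.
Proof.
apply: small_mxP => i j; rewrite mxE; case: eqP => _; last by left.
exact: small_entry1.
Qed.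

Lemma zero_col_small j : @zero_col R n j \in small_mx.
Proof.
apply: small_mxP => i k; rewrite mxE; case: ifP => _; last by left.
exact: small_entry1.
Qed.

(** One generator moves all the coefficients simultaneously one step towards
their targets, so [K] factors suffice whatever [n] and [t] are. *)
Lemma fin_diag_pow (K : nat) (z : 'I_n -> 'I_t -> int) :
  (forall i l, (`|z i l| <= K)%N) ->
  fin_diag (fun i => int_comb b (z i)) \in fset_pow small_mx K.
Proof.
elim: K z => [|K IH] z zK.
  rewrite inE; apply/eqP/matrixP=> i j; rewrite !mxE.
  case: eqP => // _; congr Some; rewrite -(int_comb0 b).
  by apply: eq_int_comb => l; have := zK i l; lia.
rewrite -add1n.
rewrite (eq_fin_diag (e := fun i => int_comb b (fun l => sgz (z i l)) +
                           int_comb b (fun l => z i l - sgz (z i l)))).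
  rewrite fin_diagD; apply: fset_powD; last first.
    by apply: IH => i l; have := zK i l; case: (sgzP (z i l)); lia.
  apply: fset_pow1; apply: small_mxP => i j; rewrite !mxE.
  case: eqP => _; last by left.
  by right; exists (fun l => sgz (z i l)) => // l; case: sgzP.
by move=> i; rewrite -int_combD; apply: eq_int_comb => l; rewrite addrC subrK.
Qed.

Lemma fin_mx_pow (K : nat) (z : 'I_n -> 'I_n -> 'I_t -> int) :
  (forall i j l, (`|z i j l| <= K)%N) ->
  (forall i, int_comb b (z i i) = 0) ->
  (forall i j k,
     int_comb b (z i j) + int_comb b (z j k) <= int_comb b (z i k)) ->
  fin_mx (fun i j => int_comb b (z i j)) \in
    fset_pow small_mx (n * (K + 1 + K)).
Proof.
move=> zK z0 z_tri; rewrite -prod_replace_col //.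
have sz : size (index_enum 'I_n) = n.
  by rewrite [index_enum _]unlock -enumT size_enum_ord.
rewrite -[X in (X * _)%N]sz.
apply: fset_pow_prod => j; rewrite replace_col_conj //.
apply: fset_powD; first apply: fset_powD.
- exact: (@fin_diag_pow K (fun i => z i j)).
- exact/fset_pow1/zero_col_small.
- rewrite (eq_fin_diag (e := fun i => int_comb b (fun l => - z i j l))).
    by apply: fin_diag_pow => i l; rewrite abszN.
  by move=> i; rewrite int_combN.
Qed.

End Generators.

(** * The group generated by the finite entries *)

Section Rank.
Variables (R : realType) (n t : nat) (b : 'I_t -> R).

(** Tropical sums select one of their terms and tropical products add, so
neither leaves the lattice. *)
Lemma subsemigroup_entries (A : 'M[tropical R]_n) i j x :
  subsemigroup_gen [set` small_mx n b] A -> A i j = Some x ->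
  range (int_comb b) x.
Proof.
pose L := [set A : 'M[tropical R]_n |
             forall i j x, A i j = Some x -> range (int_comb b) x].
suff sub : subsemigroup_gen [set` small_mx n b] `<=` L by move=> /sub; apply.
apply: smallest_sub => [B C BL CL i' j' | B /imfsetP[c _ ->] i' j' x'].
  rewrite mxE.
  elim/big_ind: _ => [//|y1 y2 y1L y2L x'|k _ x'].
    case: y1 y2 y1L y2L => [y1|] [y2|] y1L y2L //.
    - rewrite /GRing.add /= => -[<-]; rewrite maxEle.
      by case: ifP => _; [apply: y2L | apply: y1L].
    - by rewrite addr0; apply: y1L.
    - by rewrite add0r; apply: y2L.
  case EB : (B i' k) => [y1|] //; case EC : (C k j') => [y2|] // [<-].
  have [z1 _ <-] := BL _ _ _ EB; have [z2 _ <-] := CL _ _ _ EC.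
  by exists (fun l => z1 l + z2 l) => //; rewrite int_combD.
rewrite mxE; case: (c i' j') => [f|] //= [<-].
by exists (fun l => (f l)%:Z - 1).
Qed.

Lemma subgroup_gen_entries : (0 < n)%N ->
  subgroup_gen (finite_entries (subsemigroup_gen [set` small_mx n b])) =
  range (int_comb b).
Proof.
move=> n_gt0; apply/seteqP; split=> [|x [z _ <-] G [G_zmod GX]].
  apply: smallest_sub; last first.
    by move=> x [A [i [j [AX Ax]]]]; exact: subsemigroup_entries AX Ax.
  split=> [|x y]; first by apply/mem_set; exists (fun=> 0); rewrite ?int_comb0.
  move=> /set_mem[z _ <-] /set_mem[w _ <-]; apply/mem_set.
  by exists (fun l => z l - w l) => //; rewrite int_combD int_combN.
have bG l : b l \in G.
  apply/mem_set/GX; exists (const_mx (Some (b l) : tropical R)).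
  exists (Ordinal n_gt0), (Ordinal n_gt0); rewrite mxE; split=> //.
  apply: sub_gen_smallest => /=; apply: small_mxP => i j; rewrite mxE; right.
  exists (fun k => (k == l)%:Z); last by rewrite int_comb_delta.
  by move=> k; case: (k == l).
have [G0 GB] := G_zmod.
have GN y : y \in G -> - y \in G by rewrite -[- y]add0r; apply: GB.
have GD y1 y2 : y1 \in G -> y2 \in G -> y1 + y2 \in G.
  by move=> y1G y2G; rewrite -[y2]opprK; apply/GB/GN.
have GM y (m : nat) : y \in G -> y *+ m \in G.
  by move=> yG; elim: m => [|m IH]; rewrite ?mulr0n // mulrS; apply: GD.
apply/set_mem; rewrite /int_comb; elim/big_ind: _ => // l _.
case: (z l) => m; first by rewrite -pmulrn; apply: GM.
by rewrite NegzE mulrNz -pmulrn; apply/GN/GM.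
Qed.

End Rank.

(** * Many products of bounded length *)

Section Family.
Variables (R : realType) (n t : nat) (b : 'I_t -> R) (K : nat).

Definition param := {ffun 'I_n * 'I_n -> {ffun 'I_t -> 'I_K.+1}}.
Implicit Type z : param.

(** The parameters at [(i, i)] describe the diagonal factor, the parameters at
[(i, j)] with [i != j] the off-diagonal entries of the other factor. *)
Definition diag_coef z (i : 'I_n) (l : 'I_t) : int := (z (i, i) l)%:Z.

Definition off_coef z (i j : 'I_n) (l : 'I_t) : int :=
  if i == j then 0 else - (K + z (i, j) l)%:Z.

Definition family_mx z : 'M[tropical R]_n :=
  fin_diag (fun i => int_comb b (diag_coef z i)) *
  fin_mx (fun i j => int_comb b (off_coef z i j)).

Lemma card_param : #|param| = (K.+1 ^ (t * n ^ 2))%N.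
Proof. by rewrite !card_ffun card_prod !card_ord -expnM -mulnn. Qed.

(** Off-diagonal coefficients lie in [[-2K, -K]]: a sum of two of them is at
most [-2K], hence at most a third one. *)
Lemma off_coef_tri z i j k : (forall l, 0 < b l) ->
  int_comb b (off_coef z i j) + int_comb b (off_coef z j k) <=
  int_comb b (off_coef z i k).
Proof.
move=> b_gt0; rewrite -int_combD; apply: int_comb_le => // l.
rewrite /off_coef.
have [->|neq_ij] := eqVneq i j; first by rewrite add0r.
have [<-|neq_jk] := eqVneq j k; first by rewrite addr0 (negbTE neq_ij).
by case: eqP => _; have := ltn_ord (z (i, k) l); lia.
Qed.

Lemma family_mx_pow z : (forall l, 0 < b l) ->
  family_mx z \in fset_pow (small_mx n b) (K + n * (K.*2 + 1 + K.*2)).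
Proof.
move=> b_gt0; apply: fset_powD.
  by apply: fin_diag_pow => i l; rewrite /diag_coef absz_nat -ltnS ltn_ord.
apply: fin_mx_pow => [i j l|i|i j k]; last exact: off_coef_tri.
  rewrite /off_coef; case: eqP => // _.
  by have := ltn_ord (z (i, j) l); lia.
by rewrite -[RHS](int_comb0 b); apply: eq_int_comb => l; rewrite /off_coef eqxx.
Qed.

(** The second factor has zero diagonal, so the diagonal entries of the product
determine the first factor, which can then be cancelled. *)
Lemma family_mx_inj : int_free b -> injective family_mx.
Proof.
move=> bfree z w zw.
have entry i j : int_comb b (diag_coef z i) + int_comb b (off_coef z i j) =
                 int_comb b (diag_coef w i) + int_comb b (off_coef w i j).
  have := congr1 (fun A : 'M[tropical R]_n => A i j) zw.
  by rewrite /family_mx -!mulmxE !mul_diag_mx !mxE => -[].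
have diag i : int_comb b (diag_coef z i) = int_comb b (diag_coef w i).
  have off0 v : int_comb b (off_coef v i i) = 0.
    by rewrite -[RHS](int_comb0 b); apply: eq_int_comb => l;
       rewrite /off_coef eqxx.
  by have := entry i i; rewrite !off0 !addr0.
apply/ffunP=> -[i j]; apply/ffunP=> l; apply/val_inj.
have [<-|neq_ij] := eqVneq i j.
  by have := int_comb_inj bfree (diag i) l; rewrite /diag_coef => -[].
have := entry i j; rewrite diag => /addrI /(int_comb_inj bfree) /(_ l).
by rewrite /off_coef (negbTE neq_ij) => /oppr_inj[] /addnI.
Qed.

End Family.

(** The words of [family_mx_pow] have length [(4n+1)K + n], hence the choice
[K = (k - n) / (4n + 1)], for which [K + 1 >= k / (5n + 1)]. *)
Lemma growth_small_mx (R : realType) (n t : nat) (b : 'I_t -> R) k :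
  (forall l, 0 < b l) -> int_free b -> (0 < k)%N ->
  (k ^ (t * n ^ 2) <=
   (5 * n + 1) ^ (t * n ^ 2) * growth (small_mx n b) k)%N.
Proof.
move=> b_gt0 bfree k_gt0.
pose K := ((k - n) %/ (4 * n + 1))%N.
have k_le : (k <= (5 * n + 1) * K.+1)%N.
  have := divn_eq (k - n) (4 * n + 1); rewrite -/K.
  have lt_mod : ((k - n) %% (4 * n + 1) < 4 * n + 1)%N.
    by rewrite ltn_pmod ?addn1.
  by nia.
apply: (@leq_trans (((5 * n + 1) * K.+1) ^ (t * n ^ 2))).
  by case: (t * n ^ 2)%N => // m; rewrite leq_exp2r.
rewrite expnMn leq_mul2l; apply/orP; right.
(* For [k < n] the available words are too long even when [K = 0], but then
   the bound only asks that the ball be nonempty. *)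
have [le_nk|lt_kn] := leqP n k; last first.
  have -> : K = 0%N by rewrite /K divn_small; lia.
  rewrite exp1n -card_unit; apply: (@fset_pow_growth _ _ _ _ (fun=> 1)) => //.
    by move=> [] [].
  by move=> _; apply: (fset_pow_leq (small_mx1 n b) (leq0n k)); rewrite inE.
rewrite -card_param.
apply: (@fset_pow_growth _ _ _ _ (fun z : param n t K => family_mx b z)) => //.
  exact: family_mx_inj.
move=> z; apply: fset_pow_leq (family_mx_pow z b_gt0); first exact: small_mx1.
by have := leq_divM (k - n) (4 * n + 1); rewrite -/K; nia.
Qed.

Theorem theorem6p9 (R : realType) (n t : nat) (hn : (0 < n)%N) :
  exists X : {fset 'M[tropical R]_n},
    free_abelian_of_rank
      (subgroup_gen (finite_entries (subsemigroup_gen [set` X]))) t /\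
    exists c : R, 0 < c /\
      forall k : nat, (0 < k)%N ->
        c * k%:R ^+ (t * n ^ 2) <= (growth X k)%:R.
Proof.
have [b [b_gt0 bfree]] := exists_int_free R t.
exists (small_mx n b); split; first by exists b; rewrite subgroup_gen_entries.
pose C := ((5 * n + 1) ^ (t * n ^ 2))%N.
have C_gt0 : 0 < C%:R :> R by rewrite ltr0n expn_gt0 addn1.
exists C%:R^-1; split=> [|k k_gt0]; first by rewrite invr_gt0.
by rewrite ler_pdivrMl // -natrX -natrM ler_nat growth_small_mx.
Qed.
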